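(* Let $k$ be a positive integer. Then $(k+\sqrt{k^2+4})/2$ belongs to the $(2k-1)$-th derived set of $S_{\operatorname{graph}}$, and $k+1$ belongs to the $(2k)$-th derived set of $S_{\operatorname{graph}}$.
   Context: Graphs are finite simple graphs; eigenvalues are those of the adjacency matrix. A graph $G$ is a Salem graph if either it is nonbipartite, has exactly one eigenvalue $\lambda>2$ and none in $(-\infty,-2)$; or it is bipartite, has exactly one eigenvalue $\lambda>2$ and only $-\lambda$ in $(-\infty,-2)$. It is trivial if nonbipartite with $\lambda\in\mathbb Z$ or bipartite with $\lambda^2\in\mathbb Z$. For nontrivial $G$, $\tau(G)$ is the larger root of $z+1/z=\lambda$ (nonbipartite) or of $\sqrt z+1/\sqrt z=\lambda$ (bipartite). $T_{\operatorname{graph}}$ is the set of all such $\tau(G)$, and $S_{\operatorname{graph}}$ is the set of limit points of $T_{\operatorname{graph}}$ (a set of Pisot numbers). The first derived set of a real set is its set of limit points; for $j\ge2$ the $j$-th derived set is the set of limit points of the $(j-1)$-th derived set. *)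

(* Defs.v *)
From HB Require Import structures.
From mathcomp Require Import all_boot all_order all_algebra.
From mathcomp Require Import all_classical all_reals all_analysis.
Set Implicit Arguments. Unset Strict Implicit. Unset Printing Implicit Defensive.
Import Order.TTheory GRing.Theory Num.Theory.
Import numFieldNormedType.Exports.
Local Open Scope classical_set_scope.
Local Open Scope ring_scope.

Definition simple_graph n (e : rel 'I_n) : Prop :=
  (forall i j, e i j = e j i) /\ (forall i, ~~ e i i).

Definition adj (R : realType) n (e : rel 'I_n) : 'M[R]_n :=
  \matrix_(i, j) (e i j)%:R.

Definition bipartite n (e : rel 'I_n) : Prop :=
  exists c : 'I_n -> bool, forall i j, e i j -> c i != c j.

Definition salem_graph (R : realType) n (e : rel 'I_n) (lam : R) : Prop :=
  simple_graph e /\ eigenvalue (adj R e) lam /\ 2 < lam /\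
  (forall mu, eigenvalue (adj R e) mu -> 2 < mu -> mu = lam) /\
  ((~ bipartite e /\ forall mu, eigenvalue (adj R e) mu -> ~ (mu < -2)) \/
   (bipartite e /\ forall mu, eigenvalue (adj R e) mu -> mu < -2 -> mu = - lam)).

Definition trivial_salem n (e : rel 'I_n) (R : realType) (lam : R) : Prop :=
  (~ bipartite e /\ lam \is a Num.int) \/ (bipartite e /\ lam ^+ 2 \is a Num.int).

Definition tau_of n (e : rel 'I_n) (R : realType) (lam z : R) : Prop :=
  (~ bipartite e /\ z + z^-1 = lam /\ (forall w, w + w^-1 = lam -> w <= z)) \/
  (bipartite e /\ 0 <= z /\ Num.sqrt z + (Num.sqrt z)^-1 = lam /\
     (forall w, 0 <= w -> Num.sqrt w + (Num.sqrt w)^-1 = lam -> w <= z)).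

Definition T_graph (R : realType) : set R :=
  [set z | exists n (e : rel 'I_n) (lam : R),
     salem_graph e lam /\ ~ trivial_salem e lam /\ tau_of e lam z].

Definition S_graph (R : realType) : set R := limit_point (@T_graph R).
Arguments T_graph R : clear implicits.

Definition derived_set (R : realType) (j : nat) (E : set R) : set R :=
  iter j (fun A : set R => limit_point A) E.
Arguments S_graph R : clear implicits.

(* Main.v *)
(* Join a new vertex to an interior vertex of each of k paths, and possibly to
   an end of one more path. Deleting the new vertex leaves paths, so this tree
   has at most one eigenvalue above 2. Writing an eigenvalue as
   lam = y + 1/y with 0 < y < 1, so that tau = 1/y^2, and solving the eigenvector
   equation from the ends of the paths inwards, the largest eigenvalue is given by
     lam = sum_i 1/(lam - p_(a_i) - p_(b_i)) (+ p_c),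
   where p_0 = 0, p_(n+1) = 1/(lam - p_n), and p_n increases strictly to y. Hence
   sending a side length to infinity amounts to replacing its p_n by y, and
   makes the corresponding root a one-sided limit of the roots for finite
   lengths. Sending all 2k (or 2k+1) lengths to infinity leaves
   1/y^2 - y^2 = k (or 1/y^2 = k + 1), whose roots are the two limits wanted.
   Nontriviality is automatic: lam^2 approaches its limit strictly from below,
   hence is eventually not an integer. *)
Require Import Defs.
From HB Require Import structures.
From mathcomp Require Import all_boot all_order all_algebra.
From mathcomp Require Import all_classical all_reals all_analysis.
From mathcomp Require Import ring lra zify.
Import Order.TTheory GRing.Theory Num.Theory.
Import numFieldNormedType.Exports.
Local Open Scope classical_set_scope.
Local Open Scope ring_scope.
Set Implicit Arguments.
Unset Strict Implicit.
Unset Printing Implicit Defensive.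

Lemma big_option (T : Type) (idx : T) (op : Monoid.law idx) (I : finType)
    (F : option I -> T) :
  \big[op/idx]_i F i = op (F None) (\big[op/idx]_i F (Some i)).
Proof.
by rewrite ![index_enum _]unlock [@Finite.enum in LHS]unlock /= big_cons big_map.
Qed.

(** * Eigenvalues above 2 when all degrees off one vertex are at most 2 *)

Section EigenvalueUniqueness.
Variables (R : realType) (n : nat) (e : rel 'I_n).
Hypothesis e_sym : forall i j, e i j = e j i.

Let form (u v : 'I_n -> R) := \sum_i \sum_j (e i j)%:R * (u i * v j).

Lemma adj_eigenvalueP (mu : R) :
  reflect (exists2 u : 'I_n -> R,
             forall i, \sum_j (e i j)%:R * u j = mu * u i & exists i, u i != 0)
          (eigenvalue (adj R e) mu).
Proof.
apply: (iffP eigenvalueP) => [[v vE v0]|[u uE [i ui]]].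
  exists (v ord0) => [i|].
    have /rowP/(_ i) := vE; rewrite !mxE => <-.
    by apply: eq_bigr => j _; rewrite mxE e_sym mulrC.
  by have /rV0Pn [i vi] := v0; exists i.
exists (\row_j u j); last by apply/rV0Pn; exists i; rewrite mxE.
apply/rowP => j; rewrite !mxE -uE.
by apply: eq_bigr => l _; rewrite !mxE e_sym mulrC.
Qed.

(** Changing the sign of an eigenvector on one colour class negates its eigenvalue. *)
Lemma bipartite_eigenvalueN (mu : R) :
  bipartite e -> eigenvalue (adj R e) mu -> eigenvalue (adj R e) (- mu).
Proof.
move=> [c cP] /adj_eigenvalueP [u uE [i ui]]; apply/adj_eigenvalueP.
exists (fun i => (-1) ^+ c i * u i); last first.
  by exists i; rewrite mulf_neq0 // signr_eq0.
move=> l; rewrite mulrCA mulNr -uE mulrN mulr_sumr -sumrN.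
apply: eq_bigr => j _; case: (boolP (e l j)) => [/cP|_]; last by rewrite !mul0r mulr0 oppr0.
by case: (c l); case: (c j) => //= _; rewrite ?expr0 ?expr1; ring.
Qed.

Variable c : 'I_n.
Hypothesis deg2 : forall i, i != c -> (\sum_(j | j != c) e i j <= 2)%N.

(** Each edge off [c] contributes at most the mean of the squares at its ends, and each vertex lies
    on at most two such edges; edges at [c] contribute nothing since [w c = 0]. *)
Let form_le w : w c = 0 -> form w w <= 2 * \sum_i w i ^+ 2.
Proof.
move=> wc.
pose S := \sum_i \sum_j ((i != c) && (j != c) && e i j)%:R * w i ^+ 2.
have SE : S = \sum_i \sum_j ((i != c) && (j != c) && e i j)%:R * w j ^+ 2.
  rewrite /S exchange_big /=; apply: eq_bigr => i _; apply: eq_bigr => j _.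
  by rewrite e_sym (andbC (j != c)).
have le1 : form w w <= (S + S) / 2.
  rewrite {2}SE -big_split /= mulr_suml; apply: ler_sum => i _.
  rewrite -big_split /= mulr_suml; apply: ler_sum => j _.
  case: eqVneq => [->|_]; first by rewrite wc !mul0r mulr0.
  case: eqVneq => [->|_]; first by rewrite wc !mulr0 !mul0r addr0 mul0r.
  case: (e i j) => /=; last by rewrite !mul0r addr0 mul0r.
  by have := sqr_ge0 (w i - w j); nra.
suff le2 : S <= 2 * \sum_i w i ^+ 2 by lra.
rewrite mulr_sumr; apply: ler_sum => i _; rewrite -mulr_suml.
case: (eqVneq i c) => [->|ic]; first by rewrite wc expr0n /= !mulr0.
apply: ler_wpM2r; first exact: sqr_ge0.
rewrite -natr_sum ler_nat; apply: leq_trans (deg2 ic).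
rewrite [X in (_ <= X)%N]big_mkcond /=; apply: leq_sum => j _.
by case: (j != c).
Qed.

Let form_eigen (lam : R) u v :
  (forall i, \sum_j (e i j)%:R * v j = lam * v i) ->
  form u v = lam * \sum_i u i * v i.
Proof.
move=> vE; rewrite /form mulr_sumr; apply: eq_bigr => i _.
rewrite mulrCA -vE mulr_sumr; apply: eq_bigr => j _; ring.
Qed.

Let formC u v : form u v = form v u.
Proof.
rewrite /form exchange_big; apply: eq_bigr => i _; apply: eq_bigr => j _.
by rewrite e_sym (mulrC (u j)).
Qed.

Let sumsq_gt0 (u : 'I_n -> R) i : u i != 0 -> 0 < \sum_i u i ^+ 2.
Proof.
move=> ui; rewrite (bigD1 i) //= ltr_pwDl ?exprn_even_gt0 //.
by apply: sumr_ge0 => j _; exact: sqr_ge0.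
Qed.

Let eigen_center (lam : R) u i : 2 < lam -> u i != 0 ->
  (forall i, \sum_j (e i j)%:R * u j = lam * u i) -> u c != 0.
Proof.
move=> lam2 ui uE; apply/eqP => uc.
have := form_le uc; rewrite (form_eigen _ uE).
under eq_bigr do rewrite -expr2.
by have := sumsq_gt0 ui; nra.
Qed.

(* Two eigenvectors have a combination vanishing at [c], where the form is at
   most twice the squared norm because the degrees off [c] are at most 2. *)
Lemma eigenvalue_gt2_uniq (lam mu : R) : 2 < lam -> 2 < mu ->
  eigenvalue (adj R e) lam -> eigenvalue (adj R e) mu -> mu = lam.
Proof.
move=> lam2 mu2 /adj_eigenvalueP [u uE [i ui]] /adj_eigenvalueP [v vE [j vj]].
apply/eqP/contraT => neq.
have uc := eigen_center lam2 ui uE; have vc := eigen_center mu2 vj vE.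
(* Eigenvectors for distinct eigenvalues are orthogonal, so the cross terms vanish in both the norm
   and the form of [w]. *)
have uv0 : \sum_i u i * v i = 0.
  have := formC u v; rewrite (form_eigen _ uE) (form_eigen _ vE).
  under [X in _ = _ * X]eq_bigr do rewrite mulrC.
  move=> /eqP; rewrite -subr_eq0 -mulrBl mulf_eq0 subr_eq0 (negbTE neq) /=.
  by move=> /eqP.
pose w i := v c * u i - u c * v i.
have wc : w c = 0 by rewrite /w mulrC subrr.
have wE l : \sum_j (e l j)%:R * w j = lam * v c * u l - mu * u c * v l.
  have -> : lam * v c * u l - mu * u c * v l
          = v c * (lam * u l) - u c * (mu * v l) by ring.
  rewrite -uE -vE !mulr_sumr -sumrB; apply: eq_bigr => m _; rewrite /w; ring.
have nW : \sum_i w i ^+ 2 =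
    v c ^+ 2 * \sum_i u i ^+ 2 + u c ^+ 2 * \sum_i v i ^+ 2.
  transitivity (v c ^+ 2 * \sum_i u i ^+ 2 + u c ^+ 2 * \sum_i v i ^+ 2
      - 2 * u c * v c * \sum_i u i * v i); last by rewrite uv0 mulr0 subr0.
  rewrite !mulr_sumr -big_split -sumrB /=; apply: eq_bigr => m _; rewrite /w; ring.
have fW : form w w =
    lam * v c ^+ 2 * \sum_i u i ^+ 2 + mu * u c ^+ 2 * \sum_i v i ^+ 2.
  transitivity (lam * v c ^+ 2 * \sum_i u i ^+ 2 + mu * u c ^+ 2 * \sum_i v i ^+ 2
      - (lam + mu) * u c * v c * \sum_i u i * v i); last by rewrite uv0 mulr0 subr0.
  rewrite !mulr_sumr -big_split -sumrB /form /=; apply: eq_bigr => m _.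
  have -> : \sum_j (e m j)%:R * (w m * w j) = w m * \sum_j (e m j)%:R * w j.
    by rewrite mulr_sumr; apply: eq_bigr => l _; ring.
  rewrite wE /w; ring.
have := form_le wc; rewrite fW nW.
have U := sumsq_gt0 ui; have V := sumsq_gt0 vj.
have U' : 0 < v c ^+ 2 * \sum_i u i ^+ 2 by rewrite mulr_gt0 ?exprn_even_gt0.
have V' : 0 < u c ^+ 2 * \sum_i v i ^+ 2 by rewrite mulr_gt0 ?exprn_even_gt0.
rewrite -!mulrA; nra.
Qed.

End EigenvalueUniqueness.

(* A forest with a set [att] of vertices to be joined to a new vertex, and the
   function [val] solving the eigenvalue equation at [lam] when the new vertex
   carries the value 1; [g] is then the total value seen from the new vertex. *)
Record response_forest (R : realType) (lam g : R) := ResponseForest {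
  rf_V : finType;
  rf_e : rel rf_V;
  rf_att : pred rf_V;
  rf_col : rf_V -> bool;
  rf_val : rf_V -> R;
  rf_sym : forall u v, rf_e u v = rf_e v u;
  rf_irr : forall v, ~~ rf_e v v;
  rf_colP : forall u v, rf_e u v -> rf_col u != rf_col v;
  rf_attP : forall v, rf_att v -> rf_col v;
  rf_eigen : forall v,
    \sum_u (rf_e v u)%:R * rf_val u + (rf_att v)%:R = lam * rf_val v;
  rf_resp : \sum_v (rf_att v)%:R * rf_val v = g }.

(** Serves both to lengthen a path by one vertex and, at the end, to add the centre of the tree. *)
Definition cone_rel (V : Type) (e : rel V) (att : pred V) : rel (option V) :=
  fun x y => match x, y with
    | Some u, Some v => e u v
    | None, Some v | Some v, None => att v
    | None, None => false
    end.

(** * Gluing forests and tracking their responses *)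

Section ForestOperations.
Variables (R : realType) (lam : R).

Definition rf_deg g (F : response_forest lam g) (v : rf_V F) := (\sum_u rf_e v u)%N.

Definition rf_empty : response_forest lam 0.
Proof.
apply: (@ResponseForest _ _ _ void (fun _ _ => false) (fun _ => false)
  (fun _ => true) (fun _ => 0)) => //; try by case.
by apply: big1 => -[].
Defined.

(** The apex becomes the only attached vertex. Its value [t] solves [g * t + 1 = lam * t], and the
    old values are scaled by [t]. Colours are flipped because attached vertices must have colour
    [true]. *)
Definition rf_cone g (F : response_forest lam g) :
  lam - g != 0 -> response_forest lam (lam - g)^-1.
Proof.
move=> lamg.
apply: (@ResponseForest _ _ _ (option (rf_V F)) (cone_rel (@rf_e _ _ _ F) (@rf_att _ _ _ F))
  (fun x => x == None)
  (fun x => if x is Some v then ~~ rf_col v else true)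
  (fun x => (lam - g)^-1 * if x is Some v then rf_val v else 1)).
- by case=> [u|] [v|] //=; exact: rf_sym.
- by case=> [u|] //=; exact: rf_irr.
- case=> [u|] [v|] //=; try by move=> /rf_attP ->.
  by move=> /rf_colP; case: rf_col; case: rf_col.
- by case.
- case=> [u|] /=; rewrite big_option /= ?mul0r.
    rewrite addr0.
    transitivity ((lam - g)^-1 * (\sum_v (rf_e u v)%:R * rf_val v + (rf_att u)%:R)).
      rewrite mulrDr mulr_sumr addrC; congr (_ + _); last by ring.
      by apply: eq_bigr => v _; rewrite mulrCA.
    by rewrite rf_eigen; ring.
  under eq_bigr do rewrite mulrCA.
  rewrite -mulr_sumr rf_resp add0r; by field.
- rewrite big_option /= !mul1r mulr1 big1 ?addr0 // => v _; by rewrite mul0r.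
Defined.

Definition rf_union g1 g2 (F1 : response_forest lam g1) (F2 : response_forest lam g2) :
  response_forest lam (g1 + g2).
Proof.
apply: (@ResponseForest _ _ _ (rf_V F1 + rf_V F2)%type
  (fun x y => match x, y with
     | inl u, inl v => rf_e u v | inr u, inr v => rf_e u v | _, _ => false end)
  (fun x => match x with inl u => rf_att u | inr u => rf_att u end)
  (fun x => match x with inl u => rf_col u | inr u => rf_col u end)
  (fun x => match x with inl u => rf_val u | inr u => rf_val u end)).
- by case=> u [] v //=; exact: rf_sym.
- by case=> u /=; exact: rf_irr.
- by case=> u [] v //=; exact: rf_colP.
- by case=> u /=; exact: rf_attP.
- case=> u; rewrite big_sumType /= -rf_eigen; congr (_ + _).
    by rewrite [X in _ + X]big1 ?addr0 // => v _; rewrite mul0r.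
  by rewrite big1 ?add0r // => v _; rewrite mul0r.
- by rewrite big_sumType /= !rf_resp.
Defined.


(** Models a possibly empty path hung by an end: the future edge at the attached vertex is counted
    in its degree. *)
Definition arm_response g := exists F : response_forest lam g,
  (forall v : rf_V F, rf_deg v + rf_att v <= 2)%N /\ (\sum_(v : rf_V F) rf_att v <= 1)%N.

(** Edges to the centre are not counted, as in the degree hypothesis of [eigenvalue_gt2_uniq]. *)
Definition deg2_response g := exists F : response_forest lam g,
  forall v : rf_V F, (rf_deg v <= 2)%N.

Lemma arm_response0 : arm_response 0.
Proof. by exists rf_empty; split=> [[]|]; rewrite big1 // => -[]. Qed.

Lemma arm_responseV g : lam - g != 0 -> arm_response g ->
  arm_response (lam - g)^-1.
Proof.
move=> lamg [F [degF attF]]; exists (rf_cone F lamg); split; last first.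
  by rewrite big_option /= big1.
case=> [v|]; rewrite /rf_deg big_option /=; last by rewrite add0n addn1 ltnS.
by rewrite addn0 addnC; exact: degF.
Qed.

Lemma arm_deg2_response g : arm_response g -> deg2_response g.
Proof.
by move=> [F [degF _]]; exists F => v; apply: leq_trans (degF v); exact: leq_addr.
Qed.

(** Coning two arms at once makes a path whose attached vertex, the apex, has one arm on each
    side. *)
Lemma double_arm_deg2_response g h : lam - g - h != 0 ->
  arm_response g -> arm_response h -> deg2_response (lam - g - h)^-1.
Proof.
rewrite -addrA -opprD => lamgh [F [degF attF]] [G [degG attG]].
exists (rf_cone (rf_union F G) lamgh).
case=> [[v|v]|]; rewrite /rf_deg big_option big_sumType /=.
- by rewrite [X in (_ + (_ + X))%N]big1 // addn0 addnC; exact: degF.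
- by rewrite [X in (_ + (X + _))%N]big1 // add0n addnC; exact: degG.
- by rewrite add0n (leq_add attF attG).
Qed.

Lemma deg2_responseD g h :
  deg2_response g -> deg2_response h -> deg2_response (g + h).
Proof.
move=> [F degF] [G degG]; exists (rf_union F G).
case=> v; rewrite /rf_deg big_sumType /=.
- by rewrite [X in (_ + X)%N]big1 // addn0; exact: degF.
- by rewrite [X in (X + _)%N]big1 // add0n; exact: degG.
Qed.

(** Give the centre the value 1: a response equal to [lam] is then the eigenvector equation at the
    centre. Eigenvalues below -2 are handled by the bipartite symmetry. *)
Lemma deg2_response_salem : 2 < lam -> deg2_response lam ->
  exists n (e : rel 'I_n), salem_graph e lam /\ bipartite e.
Proof.
move=> lam2 [F degF]; pose V : finType := option (rf_V F).
pose ce : rel V := cone_rel (@rf_e _ _ _ F) (@rf_att _ _ _ F).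
have ce_sym x y : ce x y = ce y x.
  by case: x y => [u|] [v|] //=; exact: rf_sym.
pose e : rel 'I_#|V| := fun i j => ce (enum_val i) (enum_val j).
have e_sym i j : e i j = e j i by exact: ce_sym.
have simple : simple_graph e.
  by split=> // i; rewrite /e; case: enum_val => //= u; exact: rf_irr.
have bip : bipartite e.
  exists (fun i => if enum_val i is Some v then rf_col v else false) => i j.
  rewrite /e; case: (enum_val i) (enum_val j) => [u|] [v|] //=.
  - exact: rf_colP.
  - by move=> /rf_attP ->.
  - by move=> /rf_attP ->.
pose c : 'I_#|V| := enum_rank None.
have sumV (T : Type) (idx : T) (op : Monoid.com_law idx) (f : V -> T) :
    \big[op/idx]_(j : 'I_#|V|) f (enum_val j) = op (f None) (\big[op/idx]_v f (Some v)).
  by rewrite -big_option (reindex _ (onW_bij _ (enum_val_bij V))).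
have eig : eigenvalue (adj R e) lam.
  apply/(adj_eigenvalueP e_sym).
  pose w (x : V) : R := if x is Some v then rf_val v else 1.
  exists (fun i => w (enum_val i)); last by exists c; rewrite enum_rankK oner_eq0.
  move=> i; rewrite (sumV _ _ _ (fun x => (ce (enum_val i) x)%:R * w x)).
  case: (enum_val i) => [u|] /=; first by rewrite -rf_eigen mulr1 addrC.
  by rewrite mul0r add0r rf_resp mulr1.
have uniq mu : eigenvalue (adj R e) mu -> 2 < mu -> mu = lam.
  move=> emu mu2; apply: (@eigenvalue_gt2_uniq R _ e e_sym c) => // i ic.
  rewrite big_mkcond /=.
  have -> : (\sum_j (if j != c then e i j : nat else 0))%N =
      (\sum_(j : 'I_#|V|) (fun x => (x != None) && ce (enum_val i) x) (enum_val j))%N.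
    apply: eq_bigr => j _; rewrite /e -(inj_eq enum_val_inj) enum_rankK.
    by case: eqVneq.
  rewrite (sumV _ _ _ (fun x => nat_of_bool ((x != None) && ce (enum_val i) x))) /=.
  move: ic; rewrite -(inj_eq enum_val_inj) enum_rankK.
  by case: (enum_val i) => //= u _; exact: degF.
exists #|V|, e; split=> //; do 4?split=> //; right; split=> // mu emu mu2.
by rewrite -(uniq (- mu)) ?opprK //; [exact: bipartite_eigenvalueN|lra].
Qed.

End ForestOperations.

(** * The equation for the largest eigenvalue, in the variable [y] *)

Section CharacteristicEquation.
Variable R : realType.
Implicit Types (y lam c : R) (v : seq R).

Definition lam_of y : R := y + y^-1.

(* [None] stands for an infinitely long arm *)
Definition arm_val (a : option nat) y : R :=
  if a is Some n then iter n (fun p => (lam_of y - p)^-1) 0 else y.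

(* Consecutive entries of the list are the two sides of a path joined to the
   centre at an interior vertex; an unpaired last entry is a path joined to the
   centre at its end. *)
Fixpoint branch_sum lam v : R :=
  match v with
  | a :: b :: v' => (lam - a - b)^-1 + branch_sum lam v'
  | [:: a] => a
  | [::] => 0
  end.

Definition salem_root (s : seq (option nat)) y :=
  0 < y < 1 /\ lam_of y = branch_sum (lam_of y) [seq arm_val a y | a <- s].

Lemma pair_seq_ind (T : Type) (P : seq T -> Prop) :
  P [::] -> (forall a, P [:: a]) -> (forall a b s, P s -> P [:: a, b & s]) ->
  forall s, P s.
Proof.
move=> P0 P1 P2 s; elim: {s}(size s).+1 {-2}s (leqnn (size s).+1) => // n IH.
by case=> [|a [|b s]] //= sn; apply: P2; apply: IH; lia.
Qed.

(** Arm values are at most [y], so this keeps every denominator of [branch_sum] positive. *)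
Lemma lam_of_gt2y y : 0 < y < 1 -> 2 * y < lam_of y.
Proof.
move=> /andP[y0 y1]; have : 1 < y^-1 by rewrite invf_gt1.
by rewrite /lam_of; lra.
Qed.

Lemma lam_of_gt2 y : 0 < y < 1 -> 2 < lam_of y.
Proof.
move=> /andP[y0 y1]; rewrite /lam_of.
have : y * y^-1 = 1 by rewrite divff // gt_eqF.
have : 1 < y^-1 by rewrite invf_gt1.
nra.
Qed.

Lemma lam_of_decr y y' : 0 < y -> y < y' -> y' < 1 -> lam_of y' < lam_of y.
Proof.
move=> y0 yy' y1; have y0' : 0 < y' by lra.
have -> : lam_of y' = lam_of y - (y' - y) * (y^-1 * y'^-1 - 1).
  by rewrite /lam_of; field; rewrite !gt_eqF.
rewrite ltrBlDr ltrDl mulr_gt0 ?subr_gt0 // -invfM invf_gt1 ?mulr_gt0 //.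
by nra.
Qed.

(** The recursion [p -> (lam_of y - p)^-1] is increasing below its fixed point [y], and starts at
    0. *)
Lemma arm_val_lt n y : 0 < y < 1 -> arm_val (Some n) y < y.
Proof.
move=> y01; have /andP[y0 y1] := y01; elim: n => [|n] //=.
rewrite -/(arm_val (Some n) y) => IH.
have iy : 0 < y^-1 by rewrite invr_gt0.
by rewrite -[ltRHS]invrK ltf_pV2 ?posrE // /lam_of; lra.
Qed.

Lemma arm_val_le a y : 0 < y < 1 -> arm_val a y <= y.
Proof. by case: a => [n|] y01 //; exact/ltW/arm_val_lt. Qed.

Lemma arm_val_homo a y y' : 0 < y -> y <= y' -> y' < 1 ->
  arm_val a y <= arm_val a y'.
Proof.
move=> y0 yy' y1; case: a => [n|] //; elim: n => [|n] //=.
rewrite -/(arm_val (Some n) y) -/(arm_val (Some n) y') => IH.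
have y01 : 0 < y < 1 by lra.
have y01' : 0 < y' < 1 by lra.
have := arm_val_lt n y01; have := arm_val_lt n y01'.
have := lam_of_gt2y y01; have := lam_of_gt2y y01' => *.
rewrite lef_pV2 ?posrE; try lra.
have : lam_of y' <= lam_of y.
  by move: yy'; rewrite le_eqVlt => /orP[/eqP ->//|yy]; exact/ltW/lam_of_decr.
lra.
Qed.

(** One step multiplies the distance to [y] by [y / (lam_of y - p)], which is less than [y] since
    [lam_of y - p > y^-1 > 1]. *)
Lemma arm_val_dist n y : 0 < y < 1 -> y - arm_val (Some n) y <= y ^+ n.
Proof.
move=> y01; have /andP[y0 y1] := y01; elim: n => [|n] //=; first by rewrite expr0; lra.
have := arm_val_lt n y01; rewrite -/(arm_val (Some n) y).
set p := arm_val _ _ => py IH.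
have iy : y * y^-1 = 1 by rewrite divff // gt_eqF.
have iy1 : 1 < y^-1 by rewrite invf_gt1.
have d1 : 1 < lam_of y - p by rewrite /lam_of; lra.
have -> : y - (lam_of y - p)^-1 = y * (y - p) / (lam_of y - p).
  have -> : y * (y - p) = y * (lam_of y - p) - 1 by rewrite /lam_of -iy; ring.
  by rewrite mulrBl mul1r mulfK // gt_eqF //; lra.
rewrite ler_pdivrMr; last by lra.
rewrite exprS; have : y * (y - p) <= y * y ^+ n by rewrite ler_wpM2l // ltW.
have : 0 < y ^+ n by rewrite exprn_gt0.
have : 0 < y * y ^+ n by rewrite mulr_gt0 // exprn_gt0.
nra.
Qed.

Lemma arm_val_cvg y : 0 < y < 1 -> arm_val (Some n) y @[n --> \oo] --> y.
Proof.
move=> y01; have /andP[y0 y1] := y01.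
apply: (@squeeze_cvgr _ _ _ _ (fun n => y - y ^+ n) (fun=> y)).
- near=> n; have := arm_val_dist n y01; have := arm_val_lt n y01; lra.
- rewrite -[X in _ --> X]subr0; apply: cvgB; first exact: cvg_cst.
  by apply: cvg_expr; rewrite gtr0_norm.
- exact: cvg_cst.
Unshelve. all: by end_near.
Qed.

(** Raising the arm values and lowering [lam] both shrink the denominators, which stay positive. *)
Lemma branch_sum_le (A : Type) (f f' : A -> R) lam lam' c (s : seq A) :
  (forall a, f a <= f' a) -> (forall a, f' a <= c) -> lam' <= lam -> 2 * c < lam' ->
  branch_sum lam (map f s) <= branch_sum lam' (map f' s).
Proof.
move=> ff' f'c lamlam' clam; elim/pair_seq_ind: s => //= a b s IH.
apply: lerD => //.
have := ff' a; have := ff' b; have := f'c a; have := f'c b => *.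
by rewrite lef_pV2 ?posrE; lra.
Qed.

Lemma branch_sum_lt lam c v1 v2 x x' : 2 * c < lam ->
  (forall a, a \in v1 ++ v2 -> a <= c) -> x < x' -> x' <= c ->
  branch_sum lam (v1 ++ x :: v2) < branch_sum lam (v1 ++ x' :: v2).
Proof.
move=> clam + xx' xc; elim/pair_seq_ind: v1 => [|a|a b v1 IH] /= bd.
- case: v2 bd => [|b v2] //= bd; have := bd b (mem_head _ _) => bc.
  by rewrite ltrD2r ltf_pV2 ?posrE; lra.
- have := bd a (mem_head _ _) => ac.
  by rewrite ltrD2r ltf_pV2 ?posrE; lra.
- by rewrite ltrD2l IH // => d dv; apply: bd; rewrite !inE dv !orbT.
Qed.

(** The general filter covers both an arm length tending to infinity and continuity in [y]. *)
Lemma branch_sum_cvg (T : Type) (F : set_system T) (FF : Filter F) (A : Type)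
    (s : seq A) (f : A -> T -> R) (g : A -> R) (l : T -> R) lam c :
  2 * c < lam -> (forall a, g a <= c) -> (forall a, f a t @[t --> F] --> g a) ->
  l t @[t --> F] --> lam ->
  branch_sum (l t) [seq f a t | a <- s] @[t --> F] --> branch_sum lam (map g s).
Proof.
move=> clam gc fg llam; elim/pair_seq_ind: s => [|a|a b s IH] /=.
- exact: cvg_cst.
- exact: fg.
- apply: cvgD => //; apply: cvgV; last by do 2?apply: cvgB.
  by rewrite gt_eqF //; have := gc a; have := gc b; lra.
Qed.

Lemma lam_of_continuous y : 0 < y -> lam_of x @[x --> y] --> lam_of y.
Proof.
by move=> y0; apply: cvgD; [exact: cvg_id|apply: cvgV; [rewrite gt_eqF|exact: cvg_id]].
Qed.

Lemma arm_val_continuous a y : 0 < y < 1 -> arm_val a x @[x --> y] --> arm_val a y.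
Proof.
move=> y01; have /andP[y0 y1] := y01; case: a => [n|]; last exact: cvg_id.
elim: n => [|n IH]; first exact: cvg_cst.
apply: (@cvgV _ _ _ _ (fun x => lam_of x - arm_val (Some n) x)
  (lam_of y - arm_val (Some n) y)).
  rewrite gt_eqF // subr_gt0.
  by have := arm_val_lt n y01; have := lam_of_gt2y y01; lra.
by apply: cvgB => //; exact: lam_of_continuous.
Qed.

(** * Moving a root by cutting one infinite arm *)

(** Cutting an infinite arm puts the branch sum strictly below [lam_of] at [y], while for a large
    length it stays above [lam_of] at [y']. The intermediate value theorem gives a root strictly
    between. *)
Lemma salem_root_perturb s1 s2 y y' :
  salem_root (s1 ++ None :: s2) y -> y < y' < 1 ->
  exists n x, y < x < y' /\ salem_root (s1 ++ Some n :: s2) x.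
Proof.
move=> [y01 yE] /andP[yy' y'1]; have /andP[y0 y1] := y01.
have y01' : 0 < y' < 1 by lra.
have gap : lam_of y' < branch_sum (lam_of y') [seq arm_val a y' | a <- s1 ++ None :: s2].
  apply: lt_le_trans (lam_of_decr y0 yy' y'1) _; rewrite {1}yE.
  apply: (@branch_sum_le _ (arm_val^~ y) (arm_val^~ y') _ _ y').
  - by move=> a; apply: arm_val_homo => //; exact: ltW.
  - by move=> a; exact: arm_val_le.
  - exact/ltW/lam_of_decr.
  - exact: lam_of_gt2y.
have [n ngap] : exists n, lam_of y' <
    branch_sum (lam_of y') [seq arm_val a y' | a <- s1 ++ Some n :: s2].
  (* The outer [None] marks the arm whose length varies; the other arms, infinite ones included, are
     frozen under [Some]. *)
  pose s := map Some s1 ++ None :: map Some s2.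
  pose f (a : option (option nat)) (n : nat) := arm_val (odflt (Some n) a) y'.
  pose g (a : option (option nat)) := arm_val (odflt None a) y'.
  have fE n : [seq f a n | a <- s] = [seq arm_val a y' | a <- s1 ++ Some n :: s2].
    by rewrite !map_cat /= -!map_comp.
  have gE : map g s = [seq arm_val a y' | a <- s1 ++ None :: s2].
    by rewrite !map_cat /= -!map_comp.
  have : branch_sum (lam_of y') [seq f a n | a <- s] @[n --> \oo]
      --> branch_sum (lam_of y') (map g s).
    apply: (@branch_sum_cvg _ _ _ _ _ _ _ _ _ y').
    - exact: lam_of_gt2y.
    - by move=> a; exact: arm_val_le.
    - by case=> [a|]; [exact: cvg_cst|exact: arm_val_cvg].
    - exact: cvg_cst.
  rewrite gE => /cvgr_gt /(_ _ gap) [n _ /(_ n (leqnn n))] /=.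
  by rewrite fE; exists n.
pose h x := branch_sum (lam_of x) [seq arm_val a x | a <- s1 ++ Some n :: s2] - lam_of x.
have hy : h y < 0.
  rewrite /h subr_lt0 {2}yE !map_cat /=; apply: (@branch_sum_lt _ y).
  - exact: lam_of_gt2y.
  - by move=> a; rewrite -map_cat => /mapP[b _ ->]; exact: arm_val_le.
  - exact: arm_val_lt.
  - exact: lexx.
have hy' : 0 < h y' by rewrite /h subr_gt0.
have hc : {within `[y, y'], continuous h}.
  apply: continuous_in_subspaceT => x; rewrite inE /= in_itv /= => /andP[yx xy'].
  have x01 : 0 < x < 1 by lra.
  apply: cvgB; last by apply: lam_of_continuous; lra.
  apply: (@branch_sum_cvg _ _ _ _ _ arm_val (arm_val^~ x) _ _ x).
  - exact: lam_of_gt2y.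
  - by move=> a; exact: arm_val_le.
  - by move=> a; exact: arm_val_continuous.
  - by apply: lam_of_continuous; lra.
have [|x] := @IVT _ h y y' 0 (ltW yy') hc.
  by rewrite ge_min le_max (ltW hy) (ltW hy') orbT.
rewrite in_itv /= => /andP[yx xy'] hx.
have yx' : y < x.
  by rewrite lt_neqAle yx andbT; apply: contra_ltN hy => /eqP ->; rewrite hx.
have xy : x < y'.
  by rewrite lt_neqAle xy' andbT; apply: contra_ltN hy' => /eqP <-; rewrite hx.
exists n, x; split; first by rewrite yx'.
by split; [lra|apply/esym/eqP; rewrite -subr_eq0; apply/eqP].
Qed.

(** * From roots to Salem graphs and elements of [T_graph] *)

(** Iterated cones realise the arms, and unions add the branches; the root equation says that the
    total response is [lam_of y]. *)
Lemma salem_root_graph (s : seq nat) y : salem_root (map Some s) y ->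
  exists n (e : rel 'I_n), salem_graph e (lam_of y) /\ bipartite e.
Proof.
move=> [y01 yE]; apply: deg2_response_salem; first exact: lam_of_gt2.
have lamy := lam_of_gt2y y01.
have arm n : arm_response (lam_of y) (arm_val (Some n) y).
  elim: n => [|n IH]; first exact: arm_response0.
  by apply: (@arm_responseV _ _ (arm_val (Some n) y)) => //; rewrite gt_eqF //; have := arm_val_lt n y01; lra.
rewrite {2}yE; elim/pair_seq_ind: s {yE} => [|a|a b s IH] /=.
- exact/arm_deg2_response/arm_response0.
- exact/arm_deg2_response/arm.
- apply: deg2_responseD => //.
  apply: (@double_arm_deg2_response _ _ (arm_val (Some a) y) (arm_val (Some b) y)) => //.
  by rewrite gt_eqF //; have := arm_val_lt a y01; have := arm_val_lt b y01; lra.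
Qed.

Lemma salem_root_T_graph (s : seq nat) y : salem_root (map Some s) y ->
  lam_of y ^+ 2 \isn't a Num.int -> T_graph R (y ^- 2).
Proof.
move=> ry nint; have [/andP[y0 y1] _] := ry.
have [n [e [sal bip]]] := salem_root_graph ry.
exists n, e, (lam_of y); split=> //; split; first by case=> [[]|[_]] //; exact/negP.
right; have sq : Num.sqrt (y ^- 2) = y^-1.
  by rewrite -exprVn sqrtr_sqr gtr0_norm // invr_gt0.
do 3?split=> //.
- by rewrite invr_ge0 sqr_ge0.
- by rewrite sq invrK addrC.
move=> w w0 wE; rewrite -[w]sqr_sqrtr // -exprVn ler_sqr ?nnegrE ?sqrtr_ge0 ?invr_ge0 ?(ltW y0) //.
set r := Num.sqrt w in wE *.
have iy : y * y^-1 = 1 by rewrite divff // gt_eqF.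
have iy1 : 1 < y^-1 by rewrite invf_gt1.
have r0 : 0 <= r by exact: sqrtr_ge0.
rewrite leNgt; apply/negP => lt.
have ir : r * r^-1 = 1 by rewrite divff // gt_eqF //; lra.
have : r^-1 < y.
  by rewrite -[ltRHS]invrK ltf_pV2 ?posrE ?invr_gt0 //; lra.
move: wE; rewrite /lam_of => wE lt2.
(* The equation for [r] is quadratic with roots [y] and [y^-1], so [r] cannot exceed the larger
   one. *)
have : (r - y) * (r - y^-1) = 0.
  have -> : (r - y) * (r - y^-1) = r * (r - (y + y^-1)) + y * y^-1 by ring.
  rewrite -wE iy; have -> : r * (r - (r + r^-1)) = - (r * r^-1) by ring.
  by rewrite ir addNr.
by nra.
Qed.

(* Only finitely many integers are close to [lam_of y ^+ 2], and [lam_of] is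
   strictly decreasing. *)
Lemma near_right_lam_of_not_int y : 0 < y < 1 ->
  \forall x \near y, y < x < 1 -> lam_of x ^+ 2 \isn't a Num.int.
Proof.
move=> y01; have /andP[y0 y1] := y01.
(* The largest integer strictly below the limit: even if the limit is an integer, none lies strictly
   between it and [m]. *)
pose m := Num.ceil (lam_of y ^+ 2) - 1.
have mlt : m%:~R < lam_of y ^+ 2 by exact: ceilB1_lt.
have : lam_of x ^+ 2 @[x --> y] --> lam_of y ^+ 2.
  by rewrite expr2; apply: cvgM; exact: lam_of_continuous.
move=> /cvgr_gt /(_ _ mlt); apply: filterS => x /= mx /andP[yx x1].
have lt : lam_of x ^+ 2 < lam_of y ^+ 2.
  have x01 : 0 < x < 1 by lra.
  have := lam_of_decr y0 yx x1; have := lam_of_gt2 y01; have := lam_of_gt2 x01; nra.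
apply/negP => /intrP [i iE].
have : i%:~R < (m + 1)%:~R :> R.
  by rewrite -iE; apply: lt_le_trans lt _; rewrite subrK; exact: ceil_ge.
by rewrite iE !ltr_int in mx * => ?; lia.
Qed.

(** * Limit points and derived sets *)

Lemma nbhs_inv_sqr y (U : set R) : 0 < y -> nbhs (y ^- 2) U ->
  \forall x \near y, U (x ^- 2).
Proof.
move=> y0 nU; have : x ^- 2 @[x --> y] --> y ^- 2; last exact.
apply: (@cvgV _ _ _ _ (fun x : R => x ^+ 2)); first by rewrite expf_neq0 // gt_eqF.
by rewrite expr2; apply: cvgM; exact: cvg_id.
Qed.

Lemma near_right_witness y (P : set R) : y < 1 -> (\forall x \near y, P x) ->
  exists2 y', y < y' < 1 & forall x, y < x < y' -> P x.
Proof.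
move=> y1 /nbhs_ballP [r /= r0 rP]; exists (Num.min (y + r) ((y + 1) / 2)).
  by rewrite lt_min gt_min; lra.
move=> x; rewrite lt_min => /and3P[yx xr _]; apply: rP.
by rewrite /ball /= ltr0_norm; lra.
Qed.

(** Perturbed roots lie strictly to the right of [y] and arbitrarily close to it. With [E]
    arbitrary, this covers [T_graph] and its derived sets alike. *)
Lemma salem_root_limit (E : set R) s1 s2 y :
  salem_root (s1 ++ None :: s2) y ->
  (forall n x, salem_root (s1 ++ Some n :: s2) x ->
     lam_of x ^+ 2 \isn't a Num.int -> E (x ^- 2)) ->
  limit_point E (y ^- 2).
Proof.
move=> ry inE U nU; have [/andP[y0 y1] _] := ry.
have nbh : \forall x \near y, U (x ^- 2) /\
    (y < x < 1 -> lam_of x ^+ 2 \isn't a Num.int).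
  by apply: filterI; [exact: nbhs_inv_sqr|apply: near_right_lam_of_not_int; lra].
have [y' yy' y'P] := near_right_witness y1 nbh.
have [n [x [xy rx]]] := salem_root_perturb ry yy'.
have [Ux nint] := y'P _ xy; exists (x ^- 2); split=> //.
- rewrite -!exprVn eqrXn2 ?invr_ge0 //; try lra.
  by rewrite (inj_eq invr_inj) gt_eqF //; lra.
- by apply: (inE n) => //; apply: nint; lra.
Qed.

Lemma count_None_split (s : seq (option nat)) : (0 < count_mem None s)%N ->
  exists s1 s2, s = s1 ++ None :: s2.
Proof.
rewrite -has_count has_pred1 => sN.
by have [s1 s2] := splitPr sN; exists s1, s2.
Qed.

(** Each infinite arm accounts for one passage to limit points. The first one already leads from
    [T_graph] to [S_graph], hence [j.+1] arms for the [j]-th derived set. *)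
Lemma salem_root_derived (j : nat) (s : seq (option nat)) y :
  count_mem None s = j.+1 -> salem_root s y -> derived_set j (S_graph R) (y ^- 2).
Proof.
elim: j s y => [|j IH] s y sj; have [|s1 [s2 sE]] := @count_None_split s;
  rewrite ?sj //; rewrite {}sE in sj *; move: sj; rewrite count_cat /= => sj ry.
- apply: (salem_root_limit ry) => n x rx nint.
  have [t tE] : exists t, s1 ++ Some n :: s2 = map Some t.
    have : None \notin s1 ++ Some n :: s2.
      by rewrite -has_pred1 has_count count_cat /=; lia.
    move: (_ ++ _) => r {sj ry rx}; elim: r => [|[a|] r IHr]; first by exists [::].
      by rewrite inE /= => /IHr [t ->]; exists (a :: t).
    by rewrite inE.
  by move: rx; rewrite tE => rx; exact: salem_root_T_graph rx nint.
- apply: (salem_root_limit ry) => n x rx _; apply: IH rx.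
  by rewrite count_cat /=; lia.
Qed.

(** * The equation with all arms infinite *)

Lemma branch_sum_nseq_even k y x :
  branch_sum y (nseq k.*2 x) = k%:R * (y - x - x)^-1.
Proof.
elim: k => [|k IH] /=; first by rewrite mul0r.
by rewrite IH -[k.+1]addn1 natrD mulrDl mul1r addrC.
Qed.

Lemma branch_sum_nseq_odd k y x :
  branch_sum y (nseq k.*2.+1 x) = k%:R * (y - x - x)^-1 + x.
Proof.
elim: k => [|k IH]; first by rewrite /= mul0r add0r.
rewrite -[LHS]/((y - x - x)^-1 + branch_sum y (nseq k.*2.+1 x)).
by rewrite IH -[k.+1]addn1 natrD mulrDl mul1r addrA (addrC (_^-1)).
Qed.

End CharacteristicEquation.

Theorem theorem17 (R : realType) (k : nat) (hk : (0 < k)%N) :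
  derived_set (2 * k - 1) (S_graph R)
    ((k%:R + Num.sqrt (k%:R ^+ 2 + 4)) / 2) /\
  derived_set (2 * k) (S_graph R) (k%:R + 1).
Proof.
have k1 : 1 <= k%:R :> R by rewrite ler1n.
(* Here [y = (Num.sqrt z)^-1], and all [m.+1] arms are infinite, each of value [y]. *)
have main (z : R) m : 1 < z ->
    lam_of (Num.sqrt z)^-1 =
      branch_sum (lam_of (Num.sqrt z)^-1) (nseq m.+1 (Num.sqrt z)^-1) ->
    derived_set m (S_graph R) z.
  move=> z1 zE; have z0 : 0 < z by lra.
  have -> : z = (Num.sqrt z)^-1 ^- 2 by rewrite exprVn invrK sqr_sqrtr // ltW.
  apply: (@salem_root_derived _ _ (nseq m.+1 None)).
    by rewrite count_nseq /= mul1n.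
  split; last by rewrite map_nseq.
  by rewrite invr_gt0 sqrtr_gt0 z0 invf_lt1 ?sqrtr_gt0 // -sqrtr1 ltr_sqrt.
split.
- set z := _ / 2.
  have d0 : 0 <= k%:R ^+ 2 + 4 :> R by nra.
  have dE := sqr_sqrtr d0; have d1 := sqrtr_ge0 (k%:R ^+ 2 + 4 : R).
  have zE : z ^+ 2 = k%:R * z + 1 by rewrite /z; nra.
  have z1 : 1 < z by rewrite /z; nra.
  have r1 : 1 < Num.sqrt z by rewrite -sqrtr1 ltr_sqrt; lra.
  have rE : Num.sqrt z ^+ 2 = z by rewrite sqr_sqrtr //; lra.
  (* With [k] pairs the equation is [lam * (lam - 2 * y) = k], that is [z - z^-1 = k], which is
     [zE]. *)
  apply: main => //; have -> : (2 * k - 1).+1 = k.*2 by lia.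
  rewrite branch_sum_nseq_even /lam_of invrK.
  set r := Num.sqrt z in r1 rE *.
  have r0 : r != 0 by rewrite gt_eqF //; lra.
  have den : 1 + r * r - 1 - 1 != 0 by rewrite gt_eqF //; nra.
  have kE : k%:R = (r ^+ 4 - 1) / r ^+ 2.
    have -> : r ^+ 4 = z ^+ 2 by rewrite -rE -exprM.
    by rewrite rE zE; field; rewrite -rE expf_neq0.
  by rewrite kE; field; rewrite r0 den.
- have z1 : 1 < k%:R + 1 :> R by lra.
  set z := k%:R + 1 in z1 *.
  have r1 : 1 < Num.sqrt z by rewrite -sqrtr1 ltr_sqrt; lra.
  have rE : Num.sqrt z ^+ 2 = z by rewrite sqr_sqrtr //; lra.
  (* The unpaired arm cancels the [y] in [lam], leaving [y^-1 * (y^-1 - y) = k], that is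
     [z - 1 = k]. *)
  apply: main => //; rewrite mul2n branch_sum_nseq_odd /lam_of invrK.
  set r := Num.sqrt z in r1 rE *.
  have r0 : r != 0 by rewrite gt_eqF //; lra.
  have den : 1 + r * r - 1 - 1 != 0 by rewrite gt_eqF //; nra.
  have -> : k%:R = r ^+ 2 - 1 by rewrite rE /z addrK.
  by field; rewrite r0 den.
Qed.
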